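(* Let $p,q,r,s\in\mathbb{R}$ and $$P_5(x)=x^5+\tfrac{10p}{3}x^3+10qx^2+20rx+20s,\quad P_4(x)=x^4+2px^2+4qx+4r,\quad P_3(x)=x^3+px+q,$$ $$R_2^0(x)=-px^2-3qx,\qquad R_3^0(x)=-\tfrac43px^3-6qx^2-16rx.$$ Suppose $P_4$ has four distinct real roots $\alpha_1^{(4)}<\alpha_2^{(4)}<\alpha_3^{(4)}<\alpha_4^{(4)}$ and that $$\sup_{k\in\{1,3\}}R_3^0(\alpha_k^{(4)})<\inf_{k\in\{2,4\}}R_3^0(\alpha_k^{(4)}).$$ Then $P_5$ has five distinct real roots if and only if: $p<0$; $q\in\left]-2\left(-\frac p3\right)^{3/2};2\left(-\frac p3\right)^{3/2}\right[$ (so that $P_3$ has three distinct real roots $\alpha_1^{(3)}<\alpha_2^{(3)}<\alpha_3^{(3)}$); $$4r\in\left]R_2^0(\alpha_2^{(3)})\,;\,\inf_{k\in\{1,3\}}R_2^0(\alpha_k^{(3)})\right[;$$ and $$20s\in\left]\sup_{k\in\{1,3\}}R_3^0(\alpha_k^{(4)})\,;\,\inf_{k\in\{2,4\}}R_3^0(\alpha_k^{(4)})\right[.$$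
   Context: Here $P_4=\frac15P_5'$ and $P_3=\frac14P_4'$; $R_3^0$ and $R_2^0$ are the polynomials $R_3(x)=xP_4(x)-P_5(x)$ and $R_2(x)=xP_3(x)-P_4(x)$ with their constant terms removed. $]u;v[$ denotes an open interval. *)

(* Defs.v *)
From mathcomp Require Import all_boot all_order all_algebra.
From mathcomp Require Import polyrcf.
From mathcomp Require Import lra.
From mathcomp Require Import mathcomp_extra boolp classical_sets reals exp.

Set Implicit Arguments.
Unset Strict Implicit.
Unset Printing Implicit Defensive.

Import Order.TTheory GRing.Theory Num.Theory.

Local Open Scope classical_set_scope.
Local Open Scope ring_scope.

Section Definitions.
Variable R : realType.
Implicit Types (p q r s : R) (P : {poly R}).

Definition P5 p q r s : {poly R} :=
  'X^5 + (10 * p / 3) *: 'X^3 + (10 * q) *: 'X^2 + (20 * r) *: 'X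
  + (20 * s)%:P.

Definition P4 p q r : {poly R} :=
  'X^4 + (2 * p) *: 'X^2 + (4 * q) *: 'X + (4 * r)%:P.

Definition P3 p q : {poly R} := 'X^3 + p *: 'X + q%:P.

(* R_2^0 and R_3^0 in the usual notation: the exponent 0 only records that the
   constant term has been removed. *)
Definition R2o p q : {poly R} := - p *: 'X^2 - (3 * q) *: 'X.

Definition R3o p q r : {poly R} :=
  - (4 / 3 * p) *: 'X^3 - (6 * q) *: 'X^2 - (16 * r) *: 'X.

(* [rootsR P] is the strictly increasing list of all the real roots of [P], so
   its size is the number of distinct real roots. *)
Definition has_distinct_real_roots (n : nat) P : Prop := size (rootsR P) = n.

(* Numbered from 1; a junk value when [P] has fewer than [k] distinct roots. *)
Definition alpha P (k : nat) : R := (rootsR P)`_k.-1.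

Lemma P5_deriv p q r s : (P5 p q r s)^`() = 5 *: P4 p q r.
Proof.
apply/polyP => i.
rewrite /P5 /P4 !(coef_deriv, coefD, coefZ, coefXn, coefX, coefC).
case: i => [|[|[|[|[|i]]]]] /=; rewrite ?(mulr0, mulr1, addr0, add0r, mul0rn) //; lra.
Qed.

Lemma P4_deriv p q r : (P4 p q r)^`() = 4 *: P3 p q.
Proof.
apply/polyP => i.
rewrite /P4 /P3 !(coef_deriv, coefD, coefZ, coefXn, coefX, coefC).
case: i => [|[|[|[|i]]]] /=; rewrite ?(mulr0, mulr1, addr0, add0r, mul0rn) //; lra.
Qed.

Lemma R3oE p q r s : R3o p q r = 'X * P4 p q r - P5 p q r s + (20 * s)%:P.
Proof.
apply/polyP => i.
rewrite /R3o /P5 /P4 !(coefXM, coefN, coefD, coefZ, coefXn, coefX, coefC).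
case: i => [|[|[|[|[|[|i]]]]]] /=; rewrite ?(mulr0, mulr1, addr0, add0r, oppr0) //; lra.
Qed.

Lemma R2oE p q r : R2o p q = 'X * P3 p q - P4 p q r + (4 * r)%:P.
Proof.
apply/polyP => i.
rewrite /R2o /P3 /P4 !(coefXM, coefN, coefD, coefZ, coefXn, coefX, coefC).
case: i => [|[|[|[|[|i]]]]] /=; rewrite ?(mulr0, mulr1, addr0, add0r, oppr0) //; lra.
Qed.

End Definitions.

(* Main.v *)
Require Import Defs.
From mathcomp Require Import all_boot all_order all_algebra.
From mathcomp Require Import polyorder polyrcf ring lra.
From mathcomp Require Import mathcomp_extra boolp classical_sets reals exp.

(* A monic real polynomial [P] of degree n+1 whose derivative has n distinct
   real roots has n+1 distinct real roots iff the values of [P] at these critical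
   points alternate in sign, the last one being negative: Rolle's theorem and the
   factorization of [P] give one direction, the intermediate value theorem (with
   the signs at infinity) the other.  Since R_3^0 = x P_4 - P_5 + 20 s, the value
   of P_5 at a root of P_4 is 20 s - R_3^0 there, so for P_5 alternation is the
   interval condition on 20 s; likewise for P_4 over P_3 and for P_3 over its
   derivative. *)

Set Implicit Arguments.
Unset Strict Implicit.
Unset Printing Implicit Defensive.

Import Order.TTheory GRing.Theory Num.Theory.

Local Open Scope classical_set_scope.
Local Open Scope ring_scope.

(** * Distinct real roots of a polynomial and of its derivative *)

Section SimpleRealRoots.
Variable R : rcfType.
Implicit Types (P : {poly R}) (s t : seq R) (x y : R).

Lemma mem_rootsR P x : P != 0 -> (x \in rootsR P) = root P x.
Proof. by move=> /roots_on_rootsR <-; rewrite in_itv. Qed.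

(** The degree bound leaves no room for a root outside [s], and a strictly increasing list is
    determined by its elements. *)
Lemma rootsR_eq P s : P != 0 -> sorted <%R s -> all (root P) s ->
  (size P <= (size s).+1)%N -> rootsR P = s.
Proof.
move=> P0 ss sr sz; apply: lt_sorted_eq => //; first exact: sorted_roots.
have sub : {subset s <= rootsR P} by move=> x /(allP sr); rewrite mem_rootsR.
have rr : all (root P) (rootsR P) by apply/allP=> x; rewrite mem_rootsR.
have := max_poly_roots P0 rr (uniq_roots _ _ _) => /leq_trans /(_ sz) lsz.
by have [_ h] := uniq_min_size (sorted_uniq lt_trans ltxx ss) sub lsz.
Qed.

Lemma rootsRZ (c : R) P : c != 0 -> rootsR (c *: P) = rootsR P.
Proof.
move=> c0; have [->|P0] := eqVneq P 0; first by rewrite scaler0.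
apply: lt_sorted_eq; rewrite ?sorted_roots // => x.
by rewrite !mem_rootsR ?scaler_eq0 ?negb_or ?c0 // rootZ.
Qed.

(** Roots picked in successive gaps are increasing, and the degree bound makes them all the roots.
    It serves twice: for critical points between roots (Rolle) and for roots between critical points
    (intermediate values). *)
Lemma rootsR_gaps P t m : P != 0 -> (size P <= m.+1)%N ->
  (forall k, (k < m)%N -> exists2 x, x \in `]t`_k, t`_k.+1[ & root P x) ->
  size (rootsR P) = m /\
  forall k, (k < m)%N -> (rootsR P)`_k \in `]t`_k, t`_k.+1[.
Proof.
move=> P0 sz gap.
have /choice[f fP] : forall k, exists x, (k < m)%N ->
    (x \in `]t`_k, t`_k.+1[) /\ root P x.
  move=> k; have [km|km] := boolP (k < m)%N; last by exists 0.
  by have [x] := gap k km; exists x.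
suff -> : rootsR P = mkseq f m.
  by rewrite size_mkseq; split => // k km; rewrite nth_mkseq //; case: (fP k km).
apply: rootsR_eq => //; last by rewrite size_mkseq.
  apply/(sortedP 0) => i; rewrite size_mkseq => im.
  rewrite !nth_mkseq // ?(ltnW im) //.
  have [] := fP i (ltnW im); have [] := fP i.+1 im.
  by rewrite !in_itv /= => /andP[+ _] _ /andP[_ +] _ => h1 h2; exact: lt_trans h1.
apply/allP => x /mapP[k]; rewrite mem_iota add0n => /= km ->.
by case: (fP k km).
Qed.

(** The factors of index at most k are positive; the n - k others are negative, and each absorbs one
    factor -1. *)
Lemma prod_gap_sign s n k y : sorted <%R s -> size s = n.+1 -> (k < n)%N ->
  y \in `]s`_k, s`_k.+1[ -> 0 < (-1) ^+ (n - k) * \prod_(x <- s) (y - x).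
Proof.
move=> ss sz kn; rewrite in_itv /= => /andP[ky yk].
have le_nth i j : (i <= j < n.+1)%N -> s`_i <= s`_j.
  case/andP => ij jn; apply: (sorted_leq_nth le_trans lexx) => //.
  - by move: ss; rewrite lt_sorted_uniq_le => /andP[].
  - by rewrite inE sz (leq_ltn_trans ij).
  - by rewrite inE sz.
rewrite (big_nth 0) sz (@big_cat_nat _ _ _ k.+1) //=; last by rewrite ltnS ltnW.
rewrite mulrCA; apply: mulr_gt0.
  rewrite big_nat; apply: prodr_gt0 => i /andP[_ ik].
  by rewrite subr_gt0 (le_lt_trans _ ky) // le_nth // -ltnS ik ltnS ltnW.
have -> : (n - k = n.+1 - k.+1)%N by rewrite subSS.
rewrite -prodr_const_nat -big_split /=.
rewrite big_nat; apply: prodr_gt0 => i /andP[ki iN].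
by rewrite mulN1r opprB subr_gt0 (lt_le_trans yk) // le_nth // ki iN.
Qed.

Lemma monic_rootsR_prod P : P \is monic -> size P = (size (rootsR P)).+1 ->
  P = \prod_(x <- rootsR P) ('X - x%:P).
Proof.
move=> Pm sz; rewrite [LHS](@all_roots_prod_XsubC _ _ (rootsR P)) //.
- by rewrite (monicP Pm) scale1r.
- by apply/allP => x; rewrite mem_rootsR // monic_neq0.
- by rewrite uniq_rootsE uniq_roots.
Qed.

(* Rolle puts a critical point in each gap between consecutive roots; by the
   degree bound there are no others, so the sign of [P] at the k-th one is read
   off the factorization of [P]. *)
Lemma real_rooted_deriv P n : P \is monic -> size P = n.+2 ->
  size (rootsR P) = n.+1 ->
  size (rootsR P^`()) = n /\
  forall k, (k < n)%N -> 0 < (-1) ^+ (n - k) * P.[(rootsR P^`())`_k].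
Proof.
move=> Pm sP sr; have P0 := monic_neq0 Pm.
have dP0 : P^`() != 0 by rewrite -size_poly_eq0 size_deriv sP.
have rt k : (k < n.+1)%N -> P.[(rootsR P)`_k] = 0.
  by move=> kn; apply/rootP; rewrite -mem_rootsR // mem_nth ?sr.
have ss : sorted <%R (rootsR P) by exact: sorted_roots.
have [|k kn|sz gap] := @rootsR_gaps P^`() (rootsR P) n dP0.
- by rewrite size_deriv sP.
- have lt : (rootsR P)`_k < (rootsR P)`_k.+1.
    by move/(sortedP 0): ss; apply; rewrite sr.
  have [|x xk x0] := @poly_rolle _ _ _ P lt; first by rewrite !rt // ltnW.
  by exists x => //; apply/rootP.
split=> // k kn.
have -> : P.[(rootsR P^`())`_k] = \prod_(x <- rootsR P) ((rootsR P^`())`_k - x).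
  rewrite {1}[P in P.[_]]monic_rootsR_prod ?sr // horner_prod.
  by apply: eq_bigr => x _; rewrite hornerXsubC.
exact: prod_gap_sign (gap k kn).
Qed.

(** Adding one point far to the left and one far to the right of [s] gives n+2 points where [P]
    alternates in sign, hence a root in each of the n+1 gaps. *)
Lemma alternating_real_rooted P n s : P \is monic -> size P = n.+2 ->
  sorted <%R s -> size s = n ->
  (forall k, (k < n)%N -> 0 < (-1) ^+ (n - k) * P.[s`_k]) ->
  size (rootsR P) = n.+1.
Proof.
move=> Pm sP ss sz sgn; have P0 := monic_neq0 Pm.
(* Beyond the Cauchy bound, [P] has its signs at infinity; the sum of absolute values puts every
   point of [s] strictly between -M and M. *)
pose M := 1 + cauchy_bound P + \sum_(x <- s) `|x|.
have M0 : 0 <= \sum_(x <- s) `|x| by exact: sumr_ge0.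
have cM : cauchy_bound P <= M by rewrite /M; lra.
have sM x : x \in s -> - M < x < M.
  move=> xs; rewrite -ltr_norml /M (big_rem x) //=.
  have := cauchy_bound_ge0 P.
  have : 0 <= \sum_(y <- rem x s) `|y| by exact: sumr_ge0.
  lra.
have Mgt0 : - M < M by have := cauchy_bound_gt0 P; lra.
pose t := - M :: rcons s M.
(* The point -M shifts indices by one: [t] at k+1 is [s] at k, so the exponent n - k of the
   hypothesis becomes n+1 - (k+1). *)
have tsgn k : (k < n.+2)%N -> Num.sg P.[t`_k] = (-1) ^+ (n.+1 - k).
  case: k => [_|k].
    rewrite (sgp_minftyP (le_cauchy_bound P0)) /sgp_minfty; last first.
      by rewrite in_itv /= lerN2.
    by rewrite sP (monicP Pm) mulr1 sgrX sgrN1.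
  rewrite ltnS leq_eqVlt => /orP[/eqP ->|]; last rewrite ltnS => kn.
    rewrite (sgp_pinftyP (ge_cauchy_bound P0)) /sgp_pinfty; last first.
      by rewrite in_itv /= nth_rcons sz ltnn eqxx andbT.
    by rewrite (monicP Pm) sgr1 subnn.
  rewrite /= nth_rcons sz kn subSS.
  have /gtr0_sg := sgn k kn; rewrite sgrM sgrX sgrN1 => h.
  by rewrite -[LHS](signrMK (n - k)) h mulr1.
have tsorted k : (k < n.+1)%N -> t`_k < t`_k.+1.
  move=> kn; have : sorted <%R t.
    rewrite /t /= rcons_path path_sortedE; last exact: lt_trans.
    rewrite ss andbT; apply/andP; split.
      by apply/allP => x /sM /andP[].
    by have := mem_last (- M) s; rewrite inE => /predU1P[->|/sM /andP[]].
  by move/(sortedP 0); apply; rewrite /= size_rcons sz.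
have [|k kn|[]//] := @rootsR_gaps P t n.+1 P0; first by rewrite sP.
have [|x] := @poly_ivtoo _ P _ _ (ltW (tsorted k kn)); last by exists x.
rewrite -sgr_lt0 sgrM !tsgn ?(leqW kn) //.
have le_kn : (k <= n)%N by [].
by rewrite subSS subSn // exprS mulN1r mulNr -expr2 sqrr_sign oppr_lt0 ltr01.
Qed.

Lemma monic_coef P n : P`_n = 1 -> (forall i, (n < i)%N -> P`_i = 0) ->
  P \is monic /\ size P = n.+1.
Proof.
move=> Pn Pi; have sP : size P = n.+1.
  apply/eqP; rewrite eqn_leq; apply/andP; split; first exact/leq_sizeP.
  by rewrite ltnNge; apply/negP => /leq_sizeP/(_ n (leqnn n))/eqP; rewrite Pn oner_eq0.
by rewrite monicE lead_coefE sP /= Pn.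
Qed.

End SimpleRealRoots.

(** * Root criteria for the quintic, the quartic and the cubic *)

Section Criteria.
Variable R : realType.
Implicit Types (f : nat -> R) (p q r s x : R) (i j : nat) (P Q : {poly R}).

Lemma inf_pair f i j :
  inf [set f k | k in [set i; j]] = Num.min (f i) (f j).
Proof.
rewrite image_setU !image_set1; case: leP => [h|/ltW h].
  by rewrite inf_setU ?inf1 // => _ _ -> ->.
by rewrite setUC inf_setU ?inf1 // => _ _ -> ->.
Qed.

Lemma sup_pair f i j :
  sup [set f k | k in [set i; j]] = Num.max (f i) (f j).
Proof.
rewrite image_setU !image_set1; case: leP => [h|/ltW h].
  by rewrite sup_setU ?sup1 // => _ _ -> ->.
by rewrite setUC sup_setU ?sup1 // => _ _ -> ->.
Qed.

(** The scalar [c] absorbs the factors 5, 4 and 3 in the derivatives of [P5], [P4] and [P3]; it does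
    not move the roots. *)
Lemma real_rooted_deriv_iff P Q (c : R) n : P \is monic -> size P = n.+2 ->
  c != 0 -> P^`() = c *: Q -> size (rootsR Q) = n ->
  size (rootsR P) = n.+1 <->
  forall k, (k < n)%N -> 0 < (-1) ^+ (n - k) * P.[(rootsR Q)`_k].
Proof.
move=> Pm sP c0 dP sQ; split => [sr|].
  by have [_] := real_rooted_deriv Pm sP sr; rewrite dP rootsRZ.
by apply: alternating_real_rooted; rewrite ?sorted_roots.
Qed.

Lemma monic_P5 p q r s : P5 p q r s \is monic /\ size (P5 p q r s) = 6.
Proof.
by apply: monic_coef => [|[|[|[|[|[|[|i]]]]]]] //;
  rewrite /P5 !(coefD, coefZ, coefXn, coefX, coefC) /= ?(mulr0, addr0).
Qed.

Lemma monic_P4 p q r : P4 p q r \is monic /\ size (P4 p q r) = 5.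
Proof.
by apply: monic_coef => [|[|[|[|[|[|i]]]]]] //;
  rewrite /P4 !(coefD, coefZ, coefXn, coefX, coefC) /= ?(mulr0, addr0).
Qed.

Lemma monic_P3 p q : P3 p q \is monic /\ size (P3 p q) = 4.
Proof.
by apply: monic_coef => [|[|[|[|[|i]]]]] //;
  rewrite /P3 !(coefD, coefZ, coefXn, coefX, coefC) /= ?(mulr0, addr0).
Qed.

Lemma P3_deriv p q : (P3 p q)^`() = 3 *: ('X^2 + (p / 3)%:P).
Proof.
apply/polyP => i.
rewrite /P3 !(coef_deriv, coefD, coefZ, coefXn, coefX, coefC).
by case: i => [|[|[|i]]] /=; rewrite ?(mulr0, mulr1, addr0, add0r, mul0rn) //; lra.
Qed.

(** The product x Q(x) vanishes at a root of [Q], so the sign of [P] there becomes a comparison of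
    the constant [c] with [Q']. *)
Lemma horner_at_root P Q Q' (c x : R) :
  Q' = 'X * Q - P + c%:P -> root Q x -> P.[x] = c - Q'.[x].
Proof.
move=> -> /rootP h.
by rewrite !(hornerD, hornerN, hornerM, hornerX, hornerC) h; ring.
Qed.

Lemma P5_at_alpha p q r s k : (k < size (rootsR (P4 p q r)))%N ->
  (P5 p q r s).[(rootsR (P4 p q r))`_k]
  = 20 * s - (R3o p q r).[(rootsR (P4 p q r))`_k].
Proof.
move=> /(mem_nth 0); rewrite mem_rootsR; last first.
  by have [/monic_neq0] := monic_P4 p q r.
exact/horner_at_root/R3oE.
Qed.

Lemma P4_at_alpha p q r k : (k < size (rootsR (P3 p q)))%N ->
  (P4 p q r).[(rootsR (P3 p q))`_k]
  = 4 * r - (R2o p q).[(rootsR (P3 p q))`_k].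
Proof.
move=> /(mem_nth 0); rewrite mem_rootsR; last first.
  by have [/monic_neq0] := monic_P3 p q.
exact/horner_at_root/R2oE.
Qed.

(** [P5] must be positive at the first and third roots of [P4] and negative at the second and
    fourth: two lower and two upper bounds on 20 s. *)
Lemma quintic_real_rooted p q r s (a := alpha (P4 p q r)) :
  has_distinct_real_roots 4 (P4 p q r) ->
  has_distinct_real_roots 5 (P5 p q r s) <->
  20 * s \in `](sup [set (R3o p q r).[a k] | k in [set 1%N; 3%N]]),
               (inf [set (R3o p q r).[a k] | k in [set 2%N; 4%N]])[.
Proof.
rewrite /has_distinct_real_roots => r4; have [Pm sP] := monic_P5 p q r s.
have c0 : 5 != 0 :> R by rewrite pnatr_eq0.
rewrite (real_rooted_deriv_iff Pm sP c0 (P5_deriv p q r s) r4).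
rewrite (sup_pair (fun k => _)) (inf_pair (fun k => _)).
rewrite in_itv /= gt_max lt_min /a /alpha /=; split => [sgn|].
  have := (sgn 0 isT, sgn 1 isT, sgn 2 isT, sgn 3 isT)%N.
  rewrite !P5_at_alpha ?r4 //= => -[[[h0 h1] h2] h3].
  by apply/andP; split; apply/andP; split; lra.
move=> /andP[/andP[h0 h2] /andP[h1 h3]] k k4; rewrite P5_at_alpha ?r4 //.
by case: k k4 => [|[|[|[|]]]] //= _; lra.
Qed.

(** With three critical points the signs are negative, positive, negative, so the middle root alone
    bounds 4 r from below. *)
Lemma quartic_real_rooted p q r (a := alpha (P3 p q)) :
  has_distinct_real_roots 3 (P3 p q) ->
  has_distinct_real_roots 4 (P4 p q r) <->
  4 * r \in `]((R2o p q).[a 2%N]),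
              (inf [set (R2o p q).[a k] | k in [set 1%N; 3%N]])[.
Proof.
rewrite /has_distinct_real_roots => r3; have [Pm sP] := monic_P4 p q r.
have c0 : 4 != 0 :> R by rewrite pnatr_eq0.
rewrite (real_rooted_deriv_iff Pm sP c0 (P4_deriv p q r) r3).
rewrite (inf_pair (fun k => _)).
rewrite in_itv /= lt_min /a /alpha /=; split => [sgn|].
  have := (sgn 0 isT, sgn 1 isT, sgn 2 isT)%N.
  rewrite !P4_at_alpha ?r3 //= => -[[h0 h1] h2].
  by apply/and3P; split; lra.
move=> /and3P[h1 h0 h2] k k3; rewrite P4_at_alpha ?r3 //.
by case: k k3 => [|[|[|]]] //= _; lra.
Qed.

Lemma rootsR_sqr_sub x : 0 < x -> rootsR ('X^2 - (x ^+ 2)%:P) = [:: - x; x].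
Proof.
move=> x0; have [/monic_neq0 P0 sP] : 'X^2 - (x ^+ 2)%:P \is monic /\
    size ('X^2 - (x ^+ 2)%:P) = 3.
  by apply: monic_coef => [|[|[|[|i]]]] //;
    rewrite !(coefD, coefN, coefXn, coefC) /= ?(oppr0, addr0).
apply: rootsR_eq => //=; last by rewrite sP.
  by rewrite andbT; lra.
by rewrite !rootE !(hornerD, hornerN, hornerXn, hornerC) sqrrN subrr eqxx.
Qed.

(** For p < 0 the critical points are -c and c with c the square root of -p/3, and [P3] takes there
    the values q + 2 c^3 and q - 2 c^3; the first must be positive, the second negative. *)
Lemma cubic_real_rooted p q :
  has_distinct_real_roots 3 (P3 p q) <->
  p < 0 /\
  q \in `](- (2 * (- p / 3) `^ (3 / 2))), (2 * (- p / 3) `^ (3 / 2))[.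
Proof.
rewrite /has_distinct_real_roots; have [Pm sP] := monic_P3 p q.
have c0 : 3 != 0 :> R by rewrite pnatr_eq0.
(* By Rolle the derivative has two distinct roots, whose squares both equal -p/3; for p nonnegative
   both would be 0. *)
have pneg : size (rootsR (P3 p q)) = 3 -> p < 0.
  move=> r3; have [] := real_rooted_deriv Pm sP r3.
  rewrite P3_deriv rootsRZ //; set Q := 'X^2 + _ => sQ _.
  have Q0 : Q != 0 by apply/eqP => Q0; move: sQ; rewrite Q0 rootsR0.
  have rt k : (k < 2)%N -> (rootsR Q)`_k ^+ 2 + p / 3 = 0.
    move=> k2; have := mem_nth 0 (_ : (k < size (rootsR Q))%N).
    rewrite sQ mem_rootsR // => /(_ k2) /rootP.
    by rewrite !(hornerD, hornerXn, hornerC).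
  have : (rootsR Q)`_0 < (rootsR Q)`_1.
    by have /(sortedP 0) := sorted_roots (- cauchy_bound Q) (cauchy_bound Q) Q; apply; rewrite sQ.
  have := (rt 0 isT, rt 1 isT)%N; move: (_`_0) (_`_1) => u v [hu hv] uv.
  rewrite ltNge; apply/negP => p0.
  have u0 : u = 0 by nra.
  have v0 : v = 0 by nra.
  by move: uv; rewrite u0 v0 ltxx.
suff iffq : p < 0 -> size (rootsR (P3 p q)) = 3 <->
    q \in `](- (2 * (- p / 3) `^ (3 / 2))), (2 * (- p / 3) `^ (3 / 2))[.
  by split => [r3|[p0 /(iffq p0)]//]; have p0 := pneg r3; split=> //; apply/iffq.
move=> p0; have mp0 : 0 < - p / 3 by lra.
pose c := Num.sqrt (- p / 3).
have c_gt0 : 0 < c by rewrite sqrtr_gt0.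
have c2 : c ^+ 2 = - p / 3 by rewrite sqr_sqrtr // ltW.
(* The exponent 3/2 is split as 1/2 times 3, to pass from the real power to the cube of a square
   root. *)
have -> : (- p / 3) `^ (3 / 2) = c ^+ 3.
  rewrite [3 / 2]mulrC powRrM powR12_sqrt ?(ltW mp0) //.
  by rewrite powR_mulrn ?sqrtr_ge0.
have rQ : rootsR ('X^2 + (p / 3)%:P) = [:: - c; c].
  rewrite -rootsR_sqr_sub // c2; congr (rootsR ('X^2 + _)).
  by rewrite mulNr polyCN opprK.
rewrite (real_rooted_deriv_iff Pm sP c0 (P3_deriv p q)) ?rQ // in_itv /=.
have pE : p = - 3 * c ^+ 2 by rewrite c2; field.
have Pc : (P3 p q).[c] = q - 2 * c ^+ 3.
  by rewrite /P3 !(hornerD, hornerZ, hornerXn, hornerX, hornerC) pE; ring.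
have PNc : (P3 p q).[- c] = q + 2 * c ^+ 3.
  by rewrite /P3 !(hornerD, hornerZ, hornerXn, hornerX, hornerC) pE; ring.
split => [sgn|/andP[hl hr] [|[|]] //= _]; last 2 first.
- by rewrite PNc; lra.
- by rewrite Pc; lra.
have := (sgn 0 isT, sgn 1 isT)%N; rewrite /= Pc PNc => -[hl hr].
by apply/andP; split; lra.
Qed.

End Criteria.

Theorem theorem3 (R : realType) (p q r s : R)
  (a3 := alpha (P3 p q)) (a4 := alpha (P4 p q r))
  (roots4 : has_distinct_real_roots 4 (P4 p q r))
  (sup_lt_inf : sup [set (R3o p q r).[a4 k] | k in [set 1%N; 3%N]]
              < inf [set (R3o p q r).[a4 k] | k in [set 2%N; 4%N]]) :
  (p < 0 ->
   q \in `](- (2 * (- p / 3) `^ (3 / 2))), (2 * (- p / 3) `^ (3 / 2))[ ->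
   has_distinct_real_roots 3 (P3 p q)) /\
  (has_distinct_real_roots 5 (P5 p q r s) <->
   [/\ p < 0,
       q \in `](- (2 * (- p / 3) `^ (3 / 2))), (2 * (- p / 3) `^ (3 / 2))[,
       4 * r \in `]((R2o p q).[a3 2%N]),
                   (inf [set (R2o p q).[a3 k] | k in [set 1%N; 3%N]])[ &
       20 * s \in `](sup [set (R3o p q r).[a4 k] | k in [set 1%N; 3%N]]),
                    (inf [set (R3o p q r).[a4 k] | k in [set 2%N; 4%N]])[ ]).
Proof.
(* This makes the values [a3] genuine roots of [P3] rather than defaults of [alpha]. *)
split; first by move=> p0 hq; apply/cubic_real_rooted.
rewrite (quintic_real_rooted s roots4); split=> [hs|[]//].
have [Pm sP] := monic_P4 p q r.
(* Rolle's theorem on [P4] gives [P3] three real roots; the cubic criterion then yields the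
   conditions on p and q, and the quartic one, applied to [roots4], the condition on r. *)
have roots3 : has_distinct_real_roots 3 (P3 p q).
  have [] := real_rooted_deriv Pm sP roots4.
  by rewrite P4_deriv rootsRZ // pnatr_eq0.
have [p0 hq] := (cubic_real_rooted p q).1 roots3.
by split=> //; exact: (quartic_real_rooted r roots3).1 roots4.
Qed.
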